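(* Nontrivial large sets of simple $t$-designs over finite fields exist for $t\ge 2$. That is, there exist a prime power $q$ and integers $n,k,t,\lambda,N$ with $2\le t<k<n$, $\lambda\ge 1$ and $N\ge 2$, together with $N$ pairwise disjoint $t\text{-}(n,k,\lambda;q)$ designs $\mathcal{B}_1,\dots,\mathcal{B}_N$ in $\mathbb{F}_q^n$ whose union is the set of all $k$-dimensional subspaces of $\mathbb{F}_q^n$.
   Context: Let $\mathbb{F}_q$ be the finite field with $q$ elements and $V=\mathbb{F}_q^n$. A $k$-subspace is a $k$-dimensional linear subspace. A (simple) $t\text{-}(n,k,\lambda;q)$ design is a set $\mathcal{B}$ (no repeated members) of $k$-subspaces of $V$ such that each $t$-subspace of $V$ is contained in exactly $\lambda$ members of $\mathcal{B}$. The set of all $k$-subspaces of $V$ is the trivial design. An $LS_q[N](t,k,n)$ large set is a set of $N$ pairwise disjoint $t\text{-}(n,k,\lambda;q)$ designs (all with the same $\lambda$) whose union is the set of all $k$-subspaces of $V$; it is nontrivial if it does not consist of the trivial design alone, i.e. if $N\ge 2$. *)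

(* Defs.v *)
From HB Require Import structures.
From mathcomp Require Import all_boot all_algebra.

Set Implicit Arguments.
Unset Strict Implicit.
Unset Printing Implicit Defensive.

(* Exposes the subType instance of {vspace _} over matrices. *)
Import VectorInternalTheory.

HB.instance Definition _ (F : finFieldType) (vT : vectType F) :=
  [Countable of {vspace vT} by <:].
HB.instance Definition _ (F : finFieldType) (vT : vectType F) :=
  [Finite of {vspace vT} by <:].

Definition prime_power (q : nat) : Prop :=
  exists p e : nat, [/\ prime p, 0 < e & q = p ^ e].

Definition ksubspaces (F : finFieldType) (n k : nat) :
    {set {vspace 'rV[F]_n}} :=
  [set U : {vspace 'rV[F]_n} | \dim U == k].

(* A simple t-(n, k, lambda; q) design with q = #|F|; simplicity (no repeated
   blocks) is carried by the type {set _}. *)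
Definition subspace_design (F : finFieldType) (n t k lambda : nat)
    (B : {set {vspace 'rV[F]_n}}) : Prop :=
  B \subset ksubspaces F n k /\
  forall T : {vspace 'rV[F]_n}, T \in ksubspaces F n t ->
    #|[set U in B | (T <= U)%VS]| = lambda.

Definition large_set (F : finFieldType) (n t k lambda N : nat)
    (B : 'I_N -> {set {vspace 'rV[F]_n}}) : Prop :=
  [/\ forall i : 'I_N, subspace_design t k lambda (B i),
      forall i j : 'I_N, i != j -> [disjoint B i & B j]
    & \bigcup_(i < N) B i = ksubspaces F n k].

(* Main.v *)
Require Import Defs.
From Stdlib Require Import NArith Lia.
From HB Require Import structures.
From mathcomp Require Import all_boot all_algebra finfield zify.

(* Identify F_3^6 with F_729 = F_3[alpha], where alpha^6 = alpha^5 + 1 and alpha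
   is primitive.  As alpha^364 = -1, the projective points are the exponents
   modulo 364, and a 3-subspace U becomes a set of 13 exponents.  Colour U by
     (sum of its exponents mod 2) xor h(U),
   where h(U) depends only on the differences of exponents.  Multiplication by
   alpha adds 1 to each of the 13 exponents, so it reverses the colour.  Hence it
   suffices to check, for one line T in each orbit of <alpha> on 2-subspaces,
   that 20 of the 40 3-subspaces through T have each colour; every such line is
   spanned by 1 and alpha^j for one of 31 exponents j.  The two colour classes
   are then disjoint 2-(6,3,20;3) designs. *)

Set Implicit Arguments.
Unset Strict Implicit.
Unset Printing Implicit Defensive.

Import GRing.Theory.

(** * Coordinate codes for vectors over F_3 *)

(* Computable elements of F_3: [Some true] is 1 and [Some false] is -1. *)
Notation trit := (option bool).

Definition trit_add (a b : trit) : trit :=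
  match a, b with
  | None, _ => b
  | _, None => a
  | Some x, Some y => if x (+) y then None else Some (~~ x)
  end.
Definition code_add (s t : seq trit) := [seq trit_add x.1 x.2 | x <- zip s t].
Definition code_opp (s : seq trit) : seq trit := map (omap negb) s.

Definition trit_val (a : trit) : 'F_3 :=
  if a is Some x then (if x then 1 else -1)%R else 0%R.
Definition decode (s : seq trit) : 'rV['F_3]_6 :=
  \row_i trit_val (nth None s i).

Lemma trit_valD a b : trit_val (trit_add a b) = (trit_val a + trit_val b)%R.
Proof. by case: a => [[]|]; case: b => [[]|]; apply/eqP. Qed.

Lemma trit_valN a : trit_val (omap negb a) = (- trit_val a)%R.
Proof. by case: a => [[]|]; apply/eqP. Qed.

Lemma trit_val_inj : injective trit_val.
Proof. by case=> [[]|]; case=> [[]|] // /eqP. Qed.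

Lemma size_code_add s t : size s = size t -> size (code_add s t) = size s.
Proof. by move=> e; rewrite size_map size_zip e minnn. Qed.

Lemma size_code_opp s : size (code_opp s) = size s.
Proof. exact: size_map. Qed.

Lemma code_oppK : involutive code_opp.
Proof. by apply: mapK; case=> [[]|]. Qed.

Lemma decodeD s t : size s = 6 -> size t = 6 ->
  decode (code_add s t) = (decode s + decode t)%R.
Proof.
move=> es et; apply/rowP=> i; rewrite !mxE -trit_valD.
rewrite (nth_map (None, None)) ?size_zip ?es ?et ?ltn_ord //.
by rewrite nth_zip ?es.
Qed.

Lemma decodeN s : size s = 6 -> decode (code_opp s) = (- decode s)%R.
Proof.
by move=> es; apply/rowP=> i; rewrite !mxE -trit_valN (nth_map None) ?es.
Qed.

Lemma decode_inj s t : size s = 6 -> size t = 6 -> decode s = decode t -> s = t.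
Proof.
move=> es et /rowP eq_st; apply: (@eq_from_nth _ None) => [|i]; first by rewrite et.
rewrite es => lti; apply: trit_val_inj.
by have := eq_st (Ordinal lti); rewrite !mxE.
Qed.

(** * Powers of alpha and their discrete logarithms *)

Definition code_one : seq trit := Some true :: nseq 5 None.
(** Coordinates are relative to 1, alpha, ..., alpha^5, lowest degree first; the overflow f alpha^6
    returns as f + f alpha^5. *)
Definition code_mul_alpha (s : seq trit) : seq trit :=
  if s is [:: a; b; c; d; e; f] then [:: f; a; b; c; d; trit_add e f] else s.
Notation code_pow k := (iter k code_mul_alpha code_one).

Definition alpha_mx : 'M['F_3]_6 :=
  \matrix_(i, j) ((j == i.+1 :> nat) || (i == 5 :> nat) && (j \in [:: 0; 5]))%:R%R.
Definition mul_alpha : 'End('rV['F_3]_6) := linfun (mulmxr alpha_mx).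

Lemma size_code_mul_alpha s : size (code_mul_alpha s) = size s.
Proof. by case: s => [|? [|? [|? [|? [|? [|? []]]]]]]. Qed.

Lemma size_code_pow k : size (code_pow k) = 6.
Proof. by elim: k => //= k; rewrite size_code_mul_alpha. Qed.

Lemma decode_mul_alpha s : size s = 6 ->
  decode (code_mul_alpha s) = mul_alpha (decode s).
Proof.
case: s => [|a [|b [|c [|d [|e [|f []]]]]]] // _.
apply/rowP=> j; rewrite lfunE /= !mxE !big_ord_recl big_ord0 !mxE /=.
by case: j; do 6?[case=> [|]] => //= lti; rewrite ?trit_valD ?(mulr1, mulr0, addr0, add0r).
Qed.

(** A ternary decision tree: a logarithm is found in six branchings rather than by searching the
    powers of alpha. *)
Fixpoint trie n : Type :=
  if n is n'.+1 then (trie n' * trie n' * trie n')%type else N.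

Fixpoint build n : (seq trit -> N) -> trie n :=
  match n return (seq trit -> N) -> trie n with
  | 0 => fun f => f [::]
  | n'.+1 => fun f => (build n' (fun s => f (None :: s)),
      build n' (fun s => f (Some true :: s)),
      build n' (fun s => f (Some false :: s)))
  end.

Fixpoint trie_get n : trie n -> seq trit -> N :=
  match n return trie n -> seq trit -> N with
  | 0 => fun t _ => t
  | n'.+1 => fun '(t0, t1, t2) s =>
    if s is x :: s' then
      trie_get (match x with
            | None => t0 | Some true => t1 | Some false => t2
            end) s'
    else 0%num
  end.

(* The value at 0 is junk: [index] then returns 728. *)
Definition log_trie := Eval vm_compute in
  build 6 (fun s => N.of_nat
    (index s (traject code_mul_alpha code_one 728) %% 364)).
Definition code_log := trie_get (n := 6) log_trie.

(** Recovering k from both alpha^k and -alpha^k shows that the 364 projective points are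
    distinct. *)
Lemma code_pow_check :
  all (fun k => [&& code_pow k != nseq 6 None,
                    code_log (code_pow k) == N.of_nat k
                  & code_log (code_opp (code_pow k)) == N.of_nat k])
    (iota 0 364).
Proof. by vm_compute. Qed.

Lemma code_pow364 : code_pow 364 = code_opp code_one.
Proof. by vm_compute. Qed.

Lemma code_powP k : k < 364 ->
  [/\ code_pow k != nseq 6 None,
      code_log (code_pow k) = N.of_nat k
    & code_log (code_opp (code_pow k)) = N.of_nat k].
Proof.
move=> ltk; have /(allP code_pow_check) : k \in iota 0 364 by rewrite mem_iota.
by case/and3P=> ? /eqP ? /eqP ?.
Qed.

Definition alpha_pow k := decode (code_pow k).

Lemma powS k : alpha_pow k.+1 = mul_alpha (alpha_pow k).
Proof. by rewrite /alpha_pow iterS decode_mul_alpha ?size_code_pow. Qed.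

Lemma pow_half k : alpha_pow (k + 364) = (- alpha_pow k)%R.
Proof.
elim: k => [|k IH]; first by rewrite add0n /alpha_pow code_pow364 decodeN.
by rewrite addSn !powS IH linearN.
Qed.

Lemma pow_neq0 k : alpha_pow k != 0%R.
Proof.
elim/ltn_ind: k => k IH; case: (ltnP k 364) => [ltk|lek]; last first.
  by rewrite -(subnK lek) pow_half oppr_eq0 IH // ltn_subrL (leq_trans _ lek).
have -> : 0%R = decode (nseq 6 None).
  by apply/rowP=> i; rewrite !mxE nth_nseq if_same.
have [nz _ _] := code_powP ltk.
by apply: contraNneq nz => /decode_inj ->; rewrite ?size_code_pow.
Qed.

Lemma pow_inj k l : k < 364 -> l < 364 ->
  alpha_pow k = alpha_pow l \/ alpha_pow k = (- alpha_pow l)%R -> k = l.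
Proof.
move=> ltk ltl eq_kl; apply/Nnat.Nat2N.inj.
have [_ <- _] := code_powP ltk; have [_ logl logNl] := code_powP ltl.
case: eq_kl; first by move/decode_inj=> ->; rewrite ?size_code_pow.
rewrite -decodeN ?size_code_pow // => /decode_inj ->;
  by rewrite ?size_code_opp ?size_code_pow.
Qed.

(** * Projective points as exponents modulo 364 *)

(* Locked so that unification never unfolds the 364 elements. *)
Definition indices : seq nat := locked (iota 0 364).

Lemma mem_indices k : (k \in indices) = (k < 364).
Proof. by rewrite /indices -lock mem_iota. Qed.

Lemma indices_uniq : uniq indices.
Proof. by rewrite /indices -lock iota_uniq. Qed.

Lemma size_indices : size indices = 364.
Proof. by rewrite /indices -lock size_iota. Qed.

Definition vectors : seq 'rV['F_3]_6 :=
  0%R :: [seq alpha_pow k | k <- indices] ++ [seq (- alpha_pow k)%R | k <- indices].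

(** The listed vectors are distinct and number 1 + 2 * 364 = 3^6, so none is missing. This is the
    primitivity of alpha, obtained by counting. *)
Lemma perm_vectors : perm_eq vectors (enum {: 'rV['F_3]_6}).
Proof.
have uniq_v : uniq vectors.
  rewrite /vectors cons_uniq mem_cat cat_uniq !map_inj_in_uniq ?indices_uniq ?andbT.
  - apply/andP; split.
      apply/norP; split; apply/mapP=> -[k _ /esym/eqP]; rewrite ?oppr_eq0;
      exact/negP/pow_neq0.
    apply/hasPn=> _ /mapP[k lek ->]; apply/mapP=> -[l lel].
    rewrite !mem_indices in lek lel.
    (* A vector in both halves forces l = k, and then 2 alpha^k = 0, impossible in characteristic
       3. *)
    move=> /[dup] eq_kl /esym eq_lk.
    have Ekl : l = k by apply: pow_inj; auto.
    move: eq_kl; rewrite Ekl => /eqP; rewrite eq_sym -subr_eq0 opprK.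
    have two : (2%:R : 'F_3)%R != 0%R by [].
    rewrite -mulr2n -scaler_nat scaler_eq0 (negbTE two) /=.
    exact/negP/pow_neq0.
  - by move=> k l; rewrite !mem_indices => lek lel /oppr_inj eq_kl; apply: pow_inj; auto.
  - by move=> k l; rewrite !mem_indices => lek lel eq_kl; apply: pow_inj; auto.
have sub_v : {subset vectors <= enum {: 'rV['F_3]_6}} by move=> v _; rewrite mem_enum.
have [|_ eqi] := uniq_min_size uniq_v sub_v.
  by rewrite -cardE card_mx card_Fp // /vectors /= size_cat !size_map size_indices.
by apply: uniq_perm => //; rewrite enum_uniq.
Qed.

Definition points (U : {vspace 'rV['F_3]_6}) := [seq k <- indices | alpha_pow k \in U].

(** Apart from 0, the vectors of U come in pairs alpha^k, -alpha^k, one pair for each point. *)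
Lemma size_points U : 2 * size (points U) + 1 = 3 ^ \dim U.
Proof.
have := card_vspace U; rewrite card_Fp // => <-.
have -> : #|U| = count [in U] vectors.
  by rewrite (seq.permP perm_vectors) enumT cardE /enum_mem size_filter.
rewrite /vectors -cat1s !count_cat /= mem0v addn0 !count_map size_filter addnC.
rewrite mul2n -addnn; congr (_ + (_ + _)); apply: eq_count => k //=.
by rewrite memvN.
Qed.

Lemma pow_coverP (v : 'rV['F_3]_6) : v != 0%R ->
  exists2 k, k < 364 & v = alpha_pow k \/ v = (- alpha_pow k)%R.
Proof.
move=> nz; have : v \in vectors by rewrite (perm_mem perm_vectors) mem_enum.
rewrite inE (negPf nz) /= mem_cat => /orP[] /mapP [k ltk ->];
  by exists k; rewrite -?mem_indices //; auto.
Qed.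

(** * Counting the 3-subspaces through a 2-subspace *)

Lemma dim_add_line (U : {vspace 'rV['F_3]_6}) v : v \notin U ->
  \dim (U + <[v]>) = (\dim U).+1.
Proof.
move=> nUv; rewrite dimv_disjoint_sum; last first.
  apply/eqP; rewrite -subv0; apply/subvP=> u /memv_capP[Uu /vlineP[a def_u]].
  rewrite memv0; apply: contraNT nUv => nz_u.
  have nz_a : a != 0%R by apply: contraNneq nz_u => a0; rewrite def_u a0 scale0r.
  by rewrite -(scalerK nz_a v) -def_u memvZ.
by rewrite dim_vline addnC; case: eqP nUv => // ->; rewrite mem0v.
Qed.

(* For a complement W of T, each such U meets W in exactly one point. *)
Lemma count_extensions (P : pred {vspace 'rV['F_3]_6}) T W :
  \dim T = 2 -> \dim W = 4 -> \dim (T + W) = 6 ->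
  count (fun k => P (T + <[alpha_pow k]>)%VS) (points W) =
  #|[set U | [&& \dim U == 3, (T <= U)%VS & P U]]|.
Proof.
move=> dimT dimW dimTW; set S := [set U | _].
have TW0 : (T :&: W = 0)%VS.
  by apply/eqP; rewrite -dimv_eq0; have := dimv_sum_cap T W; lia.
(* Double counting of incidences between points of W and members of S: the only member that can
   contain alpha^k is T + <alpha^k>. *)
transitivity (\sum_(k <- points W) \sum_(U in S) (alpha_pow k \in U)).
  rewrite -sum1_count big_mkcond; apply: eq_big_seq => k.
  rewrite mem_filter => /andP[Wk _].
  have nTk : alpha_pow k \notin T.
    apply: contraNN (pow_neq0 k) => Tk.
    by rewrite -memv0 -TW0 memv_cap Tk.
  rewrite (bigID (pred1 (T + <[alpha_pow k]>)%VS)) /= addnC big1 ?add0n; last first.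
    move=> U; rewrite inE => /andP[/and3P[/eqP dimU sTU _] neU].
    apply/eqP; rewrite eqb0; apply: contra neU => Uk.
    rewrite eq_sym eqEdim dimU dim_add_line // dimT andbT subv_add sTU.
    by rewrite -memvE.
  have [PTk|nPTk] := boolP (P _).
    rewrite (big_pred1 (T + <[alpha_pow k]>)%VS) => [|U /=].
      by rewrite (subvP (addvSr _ _)) ?memv_line.
    rewrite inE andbC; case: eqP => //= ->.
    by rewrite dim_add_line // dimT addvSl PTk.
  rewrite big1 // => U; rewrite inE => /andP[/and3P[_ _ PU] /eqP defU].
  by rewrite -defU PU in nPTk.
rewrite exchange_big /= -sum1_card; apply: eq_bigr => U.
rewrite inE => /and3P[/eqP dimU sTU _].
have dimUW : \dim (U + W) = 6.
  have le6 : \dim (U + W) <= 6 by rewrite (leq_trans (dimvS (subvf _))) // dimvf.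
  have : \dim (T + W) <= \dim (U + W) by rewrite dimvS ?addvS.
  by rewrite dimTW; lia.
have dim_cap : \dim (U :&: W) = 1 by have := dimv_sum_cap U W; rewrite dimUW dimU dimW; lia.
have := size_points (U :&: W)%VS; rewrite dim_cap -[3 ^ 1]/3.
have -> : \sum_(k <- points W) (alpha_pow k \in U) = size (points (U :&: W)%VS).
  rewrite big_filter size_filter -sum1_count [LHS]big_mkcond [RHS]big_mkcond /=.
  by apply: eq_bigr => k _; rewrite memv_cap; case: (_ \in U); case: (_ \in W).
by lia.
Qed.

(** * Computing the points of a span from codes *)

Definition ext (sp : seq (seq trit)) c :=
  sp ++ c :: [seq code_add s c | s <- sp] ++ [seq code_add (code_opp s) c | s <- sp].

(* [sp] contains a representative of every pair {v, -v} of nonzero vectors of U. *)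
Definition covers (sp : seq (seq trit)) (U : {vspace 'rV['F_3]_6}) :=
  {in sp, forall s, size s = 6} /\
  {in U, forall v, v = 0%R \/ exists2 s, s \in sp & v = decode s \/ v = (- decode s)%R}.

Lemma F3_cases (a : 'F_3) : [\/ a = 0, a = 1 | a = -1]%R.
Proof.
by case: a => [[|[|[|]]]] // ?; [constructor 1 | constructor 2 | constructor 3];
  apply/val_inj.
Qed.

Lemma covers_ext sp c U : size c = 6 -> covers sp U ->
  covers (ext sp c) (U + <[decode c]>).
Proof.
move=> sz_c [sz_sp cov]; split=> [s|].
  rewrite mem_cat inE mem_cat => /or4P[/sz_sp//|/eqP->//||] /mapP[t /sz_sp sz_t ->];
    by rewrite size_code_add ?size_code_opp ?sz_t.
have cov1 u : u \in U -> exists2 s, s \in ext sp c &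
    (u + decode c)%R = decode s \/ (u + decode c)%R = (- decode s)%R.
  case/cov=> [->|[s sp_s def_u]].
    by exists c; rewrite ?add0r; [rewrite mem_cat mem_head orbT | left].
  have sz_s := sz_sp s sp_s; case: def_u => ->.
    exists (code_add s c); last by left; rewrite decodeD.
    by rewrite mem_cat inE mem_cat; apply/or4P/Or43/mapP; exists s.
  exists (code_add (code_opp s) c); last by left; rewrite decodeD ?decodeN ?size_code_opp.
  by rewrite mem_cat inE mem_cat; apply/or4P/Or44/mapP; exists s.
move=> v /memv_addP[u Uu [_ /vlineP[a ->] ->]]; case: (F3_cases a) => ->.
- rewrite scale0r addr0; case: (cov u Uu) => [|[s sp_s def_u]]; first by left.
  by right; exists s; rewrite // mem_cat sp_s.
- by right; rewrite scale1r; apply: cov1.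
(* Coefficient -1: u - c is the opposite of -u + c, to which [cov1] applies. *)
have [|s sp_s def_u] := cov1 (- u)%R; first by rewrite memvN.
right; exists s => //; rewrite scaleN1r -[(u - _)%R]opprK opprB addrC.
by case: def_u => ->; rewrite ?opprK; [right | left].
Qed.

Lemma points_covered sp U : covers sp U ->
  {subset [seq N.of_nat k | k <- points U] <= [seq code_log s | s <- sp]}.
Proof.
move=> [sz_sp cov] _ /mapP[k Uk ->].
move: Uk; rewrite mem_filter mem_indices => /andP[Uk ltk].
have [nz logk logNk] := code_powP ltk.
have [/eqP|[s sp_s def_k]] := cov _ Uk; first by rewrite (negPf (pow_neq0 k)).
apply/mapP; exists s => //; have sz_s := sz_sp s sp_s.
case: def_k; first by move/decode_inj=> <-; rewrite ?size_code_pow.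
rewrite -decodeN // => /decode_inj eq_k.
by rewrite -(code_oppK s) -eq_k ?size_code_opp ?size_code_pow.
Qed.

(** Every point occurs among the logarithms, and equal lengths leave no room for repetitions or
    extra values. *)
Lemma perm_points sp U : covers sp U -> size sp = size (points U) ->
  perm_eq [seq code_log s | s <- sp] [seq N.of_nat k | k <- points U].
Proof.
move=> /points_covered sub_pts eq_sz.
have uniq_pts : uniq [seq N.of_nat k | k <- points U].
  by rewrite (map_inj_uniq Nnat.Nat2N.inj) filter_uniq ?indices_uniq.
have le_sz : size [seq code_log s | s <- sp] <= size [seq N.of_nat k | k <- points U].
  by rewrite !size_map eq_sz.
have [_ eqi] := uniq_min_size uniq_pts sub_pts le_sz.
by rewrite perm_sym; apply: uniq_perm; rewrite // (leq_size_uniq uniq_pts sub_pts).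
Qed.

Definition span_pow (ks : seq nat) : {vspace 'rV['F_3]_6} :=
  foldr (fun k U => U + <[alpha_pow k]>)%VS 0%VS ks.

Definition span_codes (ks : seq nat) : seq (seq trit) :=
  foldr (fun k sp => ext sp (code_pow k)) [::] ks.

(** Linear independence as a computation: each exponent is looked up among the points spanned by the
    later ones. *)
Fixpoint independent (ks : seq nat) : bool :=
  if ks is k :: ks' then
    [&& k < 364, N.of_nat k \notin [seq code_log s | s <- span_codes ks']
      & independent ks']
  else true.

Lemma covers_span ks : covers (span_codes ks) (span_pow ks).
Proof.
elim: ks => [|k ks IH] /=; last exact: covers_ext (size_code_pow k) IH.
by split=> // v; rewrite memv0 => /eqP; left.
Qed.

Lemma span_pow_cat ks ls : (span_pow (ks ++ ls) = span_pow ks + span_pow ls)%VS.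
Proof.
by elim: ks => [|k ks IH] /=; rewrite ?add0v // IH -!addvA (addvC <[_]>%VS).
Qed.

Lemma dim_span_pow ks : independent ks -> \dim (span_pow ks) = size ks.
Proof.
elim: ks => [|k ks IH] /=; first by rewrite dimv0.
case/and3P=> ltk nk /IH dim_ks; rewrite dim_add_line ?dim_ks //.
apply: contraNN nk => ks_k; apply: (points_covered (covers_span ks)).
by rewrite map_f // mem_filter ks_k mem_indices.
Qed.

Lemma perm_span_points ks : \dim (span_pow ks) = size ks ->
  perm_eq [seq code_log s | s <- span_codes ks]
          [seq N.of_nat k | k <- points (span_pow ks)].
Proof.
move=> dim_ks; apply: perm_points; first exact: covers_span.
have := size_points (span_pow ks); rewrite dim_ks => {dim_ks}.
have : 2 * size (span_codes ks) + 1 = 3 ^ size ks.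
  elim: ks => //= k ks; rewrite expnS size_cat /= size_cat !size_map; lia.
lia.
Qed.

(** * The colouring and its reversal under a shift of exponents *)

HB.instance Definition _ := Monoid.isComLaw.Build N 0%num N.add
  N.add_assoc N.add_comm N.add_0_l.

Definition Nsum : seq N -> N := foldr N.add 0%num.

(* Written so that it depends only on x - y mod 364, up to sign. *)
Definition weight (x y : N) : N :=
  let d := if N.leb x y then N.sub y x else N.sub x y in
  N.mul d (N.sub 364%num d).

(* Found by computer: among the colourings invariant under x |-> x^9 and reversed
   by alpha, one was chosen for which the sum of the weights modulo 347 separates
   the two values of h. *)
Definition residues : seq N :=
  [:: 10; 47; 53; 76; 95; 105; 117; 122; 163; 175; 180; 207; 211; 219; 220; 222;
      237; 242; 266; 317; 326; 335]%num.

Definition pair_sum (l : seq N) : N :=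
  Nsum [seq Nsum [seq weight x y | y <- l] | x <- l].

Definition color (l : seq N) : bool :=
  N.odd (Nsum l) (+) (N.modulo (pair_sum l) 347 \in residues).

Lemma perm_Nsum l l' : perm_eq l l' -> Nsum l = Nsum l'.
Proof. by move=> eq_l; rewrite /Nsum !foldrE; apply: perm_big. Qed.

Lemma perm_color l l' : perm_eq l l' -> color l = color l'.
Proof.
move=> eq_l; rewrite /color (perm_Nsum eq_l).
suff -> : pair_sum l = pair_sum l' by [].
rewrite /pair_sum (perm_Nsum (perm_map _ eq_l)); congr Nsum; apply: eq_map => x.
exact/perm_Nsum/perm_map.
Qed.

Definition shift_index k := if k == 363 then 0 else k.+1.

(** The distance d changes only if exactly one index wraps from 363 to 0; it then becomes 364 - d,
    which leaves d (364 - d) unchanged. *)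
Lemma weight_shift k l : k < 364 -> l < 364 ->
  weight (N.of_nat (shift_index k)) (N.of_nat (shift_index l)) = weight (N.of_nat k) (N.of_nat l).
Proof.
move=> ltk ltl; pose wt d := N.mul d (N.sub 364%num d).
have wtC d d' : N.add d d' = 364%num -> wt d = wt d'.
  by move=> dd'; rewrite /wt N.mul_comm; congr N.mul; lia.
rewrite /weight -!/(wt _) /shift_index.
case: eqP => [->|/eqP nek]; case: eqP => [->|/eqP nel] //;
  do 2?case: N.leb_spec => ?; solve [congr wt; lia | apply: wtC; lia].
Qed.

(** Every exponent changes parity, even at the wrap since 363 is odd, and the number of exponents is
    odd. *)
Lemma color_shift s : all (fun k => k < 364) s -> odd (size s) ->
  color [seq N.of_nat (shift_index k) | k <- s] = ~~ color [seq N.of_nat k | k <- s].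
Proof.
move=> lt_s odd_s; rewrite /color -addNb.
have -> : N.odd (Nsum [seq N.of_nat (shift_index k) | k <- s])
        = ~~ N.odd (Nsum [seq N.of_nat k | k <- s]).
  (* Replacing the negation by a sum with [odd (size s)] gives a statement that holds for all
     lengths and can be proved by induction. *)
  rewrite -[RHS]addTb -odd_s; elim: s lt_s {odd_s} => //= k s IH /andP[ltk /IH{}IH].
  have odd_shift : N.odd (N.of_nat (shift_index k)) = ~~ N.odd (N.of_nat k).
    rewrite /shift_index; case: eqP => [-> //|_].
    by rewrite Nnat.Nat2N.inj_succ N.odd_succ -N.negb_odd.
  rewrite !N.odd_add odd_shift IH.
  by case: (N.odd _) (odd _) (N.odd _) => [] [] [].
suff -> : pair_sum [seq N.of_nat (shift_index k) | k <- s] =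
          pair_sum [seq N.of_nat k | k <- s] by [].
rewrite /pair_sum -!map_comp; congr Nsum; apply/eq_in_map => k /(allP lt_s) ltk /=.
congr Nsum; rewrite -!map_comp.
by apply/eq_in_map => l /(allP lt_s) ltl /=; apply: weight_shift.
Qed.

(** * Multiplication by alpha acting on subspaces *)

Lemma mul_alpha_ker0 : lker mul_alpha == 0%VS.
Proof.
rewrite -subv0; apply/subvP=> v; rewrite memv_ker memv0.
apply: contraTT => /pow_coverP[k _ []] ->; last rewrite linearN oppr_eq0 /=;
  by rewrite -powS pow_neq0.
Qed.

Lemma memv_mul_alpha v U : (mul_alpha v \in (mul_alpha @: U)%VS) = (v \in U).
Proof. by rewrite !memvE -limg_line limg_ker0 ?mul_alpha_ker0. Qed.

Lemma dim_mul_alpha U : \dim (mul_alpha @: U) = \dim U.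
Proof. by rewrite limg_dim_eq // (eqP mul_alpha_ker0) capv0. Qed.

Lemma memv_pow_shift k U : k < 364 ->
  (alpha_pow (shift_index k) \in (mul_alpha @: U)%VS) = (alpha_pow k \in U).
Proof.
move=> ltk; rewrite -[RHS]memv_mul_alpha -powS /shift_index.
by case: eqP => [->|//]; rewrite -[364]add0n pow_half memvN.
Qed.

Lemma perm_points_mul_alpha U :
  perm_eq (points (mul_alpha @: U)) [seq shift_index k | k <- points U].
Proof.
have perm_shift : perm_eq indices [seq shift_index k | k <- indices].
  have uniq_shift : uniq [seq shift_index k | k <- indices].
    rewrite map_inj_in_uniq ?indices_uniq // => k l; rewrite !mem_indices /shift_index.
    by do 2?case: eqP; lia.
  have sub_shift : {subset [seq shift_index k | k <- indices] <= indices}.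
    move=> _ /mapP[k + ->]; rewrite !mem_indices /shift_index; case: eqP; lia.
  have [|_ eqi] := uniq_min_size uniq_shift sub_shift; first by rewrite size_map.
  by apply: uniq_perm; rewrite ?indices_uniq.
rewrite (permPl (perm_filter _ perm_shift)) filter_map.
rewrite (@eq_in_filter _ _ (fun k => alpha_pow k \in U)) // => k.
by rewrite mem_indices => ltk /=; apply: memv_pow_shift.
Qed.

Definition block (U : {vspace 'rV['F_3]_6}) := color [seq N.of_nat k | k <- points U].

Lemma block_mul_alpha U : \dim U = 3 -> block (mul_alpha @: U) = ~~ block U.
Proof.
move=> dimU; rewrite /block (perm_color (perm_map _ (perm_points_mul_alpha U))).
rewrite -map_comp color_shift //.
  by apply/allP=> k; rewrite mem_filter mem_indices => /andP[].
have := size_points U; rewrite dimU -[3 ^ 3]/27 => sizeU.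
by have -> : size (points U) = 13 by lia.
Qed.

Definition degree (T : {vspace 'rV['F_3]_6}) b :=
  #|[set U | [&& \dim U == 3, (T <= U)%VS & block U == b]]|.

(** U to alpha U is a bijection from the 3-subspaces through T to those through alpha T, and it
    reverses colours. *)
Lemma degree_mul_alpha T b : degree (mul_alpha @: T) b = degree T (~~ b).
Proof.
have inj_img : injective (lfun_img mul_alpha).
  by move=> U V /eqP; rewrite eq_limg_ker0 ?mul_alpha_ker0 // => /eqP.
rewrite /degree -[RHS](card_imset _ inj_img); apply: eq_card => W.
rewrite -[W](lpreimK (f := mul_alpha)); last by rewrite lker0_limgf ?subvf ?mul_alpha_ker0.
set U := (_ @^-1: W)%VS; rewrite mem_imset // !inE dim_mul_alpha limg_ker0 ?mul_alpha_ker0 //.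
by case: eqP => //= /block_mul_alpha ->; rewrite (can2_eq negbK negbK).
Qed.

(** * Orbit representatives of lines and their degrees *)

(** The 11011 lines form 31 orbits: 30 of length 364, and one of length 91 containing the subfield
    F_9, represented by j = 91. *)
Definition base_exponents : seq nat :=
  [:: 1; 7; 8; 9; 10; 11; 12; 13; 15; 16; 21; 24; 25; 26; 27; 28; 32; 33; 36; 41; 42;
      43; 47; 63; 64; 69; 77; 91; 92; 116; 267].

Notation line j := (span_pow [:: j; 0]).

(* A common complement of all the lines [line j] with j in [base_exponents]. *)
Definition transversal : seq nat := [:: 2; 3; 4; 5].

Definition extension_colors j : seq bool :=
  [seq color [seq code_log s | s <- span_codes [:: N.to_nat n; j; 0]]
     | n <- [seq code_log s | s <- span_codes transversal]].

(** Independence certifies that the transversal is a complement of [line j]; its 40 points then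
    index the 40 extensions of that line. *)
Lemma base_balanced :
  all (fun j => [&& independent (transversal ++ [:: j; 0]),
                    count id (extension_colors j) == 20
                  & count negb (extension_colors j) == 20]) base_exponents.
Proof. by vm_compute. Qed.

(* Every line through 1 contains two points whose exponents differ by an element
   of [base_exponents]. *)
Lemma base_complete :
  all (fun m => let l := [seq code_log t | t <- span_codes [:: m; 0]] in
                has (fun j => has (fun u =>
                  N.add u (N.of_nat j) \in l ++ [seq N.add v 364 | v <- l]) l)
                base_exponents) (iota 1 363).
Proof. by vm_compute. Qed.

Lemma base_bounds j : j \in base_exponents -> 0 < j < 364.
Proof. by move: j; apply/allP. Qed.

Lemma pow_notin_line k l : k < 364 -> l < 364 -> k != l ->
  alpha_pow k \notin <[alpha_pow l]>%VS.
Proof.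
move=> ltk ltl; apply: contraNN => /vlineP[a]; case: (F3_cases a) => ->.
- by rewrite scale0r => /eqP; rewrite (negPf (pow_neq0 k)).
- by rewrite scale1r => eq_kl; apply/eqP/pow_inj; auto.
- by rewrite scaleN1r => eq_kl; apply/eqP/pow_inj; auto.
Qed.

Lemma dim_line_pow k l : k < 364 -> l < 364 -> k != l ->
  \dim (<[alpha_pow k]> + <[alpha_pow l]>) = 2.
Proof.
move=> ltk ltl nekl; rewrite dim_add_line; last by rewrite pow_notin_line // eq_sym.
by rewrite dim_vline pow_neq0.
Qed.

Lemma lineE j : line j = (<[alpha_pow 0]> + <[alpha_pow j]>)%VS.
Proof. by rewrite /= add0v. Qed.

Lemma dim_line j : 0 < j < 364 -> \dim (line j) = 2.
Proof. by case/andP=> j_gt0 ltj; rewrite lineE dim_line_pow // eq_sym -lt0n. Qed.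

Lemma independent_catr ks ls : independent (ks ++ ls) -> independent ls.
Proof. by elim: ks => //= k ks IH /and3P[_ _ /IH]. Qed.

Lemma degree_base j b : j \in base_exponents -> degree (line j) b = 20.
Proof.
move=> base_j; have /and3P[indep /eqP pos /eqP neg] := allP base_balanced j base_j.
have dimT := dim_span_pow (independent_catr indep).
have dimW : \dim (span_pow transversal) = 4 by apply: dim_span_pow; vm_compute.
have dimTW : \dim (line j + span_pow transversal) = 6.
  by rewrite addvC -span_pow_cat dim_span_pow.
rewrite /degree -(count_extensions (fun U => block U == b) dimT dimW dimTW).
transitivity (count (if b then id else negb) (extension_colors j)); last by case: b.
have perm_W := perm_span_points dimW.
rewrite count_map (seq.permP perm_W) count_map; apply: eq_in_count => k.
rewrite mem_filter => /andP[Wk _].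
rewrite -[RHS]/((if b then id else negb) (color [seq code_log s | s <-
  span_codes [:: N.to_nat (N.of_nat k); j; 0]])) Nnat.Nat2N.id.
(* Dimension 3 is what makes the computed list of logarithms exactly the point list of the
   extension. *)
have dimU : \dim (span_pow [:: k; j; 0]) = 3.
  rewrite -[span_pow _]/(line j + <[alpha_pow k]>)%VS dim_add_line ?dimT //.
  apply: contraNN (pow_neq0 k) => Tk.
  have TW0 : (line j :&: span_pow transversal = 0)%VS.
    apply/eqP; rewrite -dimv_eq0.
    by have := dimv_sum_cap (line j) (span_pow transversal); rewrite dimT dimW dimTW /=; lia.
  by rewrite -memv0 -TW0 memv_cap Tk.
rewrite (perm_color (perm_span_points dimU)) -/(block _).
by case: b; case: block.
Qed.

Lemma line_iter u j :
  iter u (lfun_img mul_alpha) (line j) = (<[alpha_pow u]> + <[alpha_pow (u + j)]>)%VS.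
Proof.
rewrite lineE; elim: u => //= u ->.
by rewrite limgD !limg_line -!powS addSn.
Qed.

(** [base_complete] gives two points u and u + j on [line m]; they span it, so it is alpha^u times
    [line j]. *)
Lemma line_base m : 0 < m < 364 ->
  exists2 j, j \in base_exponents & exists u, line m = iter u (lfun_img mul_alpha) (line j).
Proof.
move=> m_bounds; have /(allP base_complete)/hasP[j base_j /hasP[x]] : m \in iota 1 363.
  by rewrite mem_iota.
have perm_m := perm_span_points (dim_line m_bounds).
rewrite (perm_mem perm_m) => /mapP[u m_u ->{x}].
rewrite mem_cat (perm_mem perm_m) => m_v; exists j => //; exists u.
have {}m_v : alpha_pow (u + j) \in line m.
  (* The sum u + j can exceed 363; it is then v + 364 for a point v, and alpha^(u + j) =
     -alpha^v. *)
  case/orP: m_v => [|/mapP[y]].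
    by rewrite -Nnat.Nat2N.inj_add (mem_map Nnat.Nat2N.inj) mem_filter => /andP[].
  rewrite (perm_mem perm_m) => /mapP[v m_v ->].
  rewrite -[N.add (N.of_nat v) _](Nnat.Nat2N.inj_add v 364) -Nnat.Nat2N.inj_add.
  move/Nnat.Nat2N.inj=> eq_uj; rewrite (eq_uj : u + j = v + 364) pow_half memvN.
  by move: m_v; rewrite mem_filter => /andP[].
move: m_u; rewrite mem_filter => /andP[m_u _].
have j_bounds := base_bounds base_j.
rewrite line_iter; apply/eqP; rewrite eq_sym eqEdim subv_add -!memvE m_u m_v andTb.
rewrite -line_iter.
have dim_iter U : \dim (iter u (lfun_img mul_alpha) U) = \dim U.
  by elim: u {m_u m_v} => //= u <-; rewrite dim_mul_alpha.
by rewrite dim_iter !dim_line.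
Qed.

(** Each step swaps the two colours, harmless as both degrees are 20. *)
Lemma degree_iter T n : (forall b, degree T b = 20) ->
  forall b, degree (iter n (lfun_img mul_alpha) T) b = 20.
Proof. by move=> degT; elim: n => //= n IH b; rewrite degree_mul_alpha. Qed.

Lemma degree_line T b : \dim T = 2 -> degree T b = 20.
Proof.
move=> dimT.
have [k ltk Tk] : exists2 k, k < 364 & alpha_pow k \in T.
  have /pow_coverP[k ltk def_v] : vpick T != 0%R by rewrite vpick0 -dimv_eq0 dimT.
  by exists k => //; case: def_v (memv_pick T) => ->; rewrite ?memvN.
have [l ltl /andP[Tl nkl]] : exists2 l, l < 364 &
    (alpha_pow l \in T) && (alpha_pow l \notin <[alpha_pow k]>%VS).
  have /subvPn[v Tv nkv] : ~~ (T <= <[alpha_pow k]>)%VS.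
    by apply: contraTN isT => /dimvS; rewrite dimT dim_vline; case: (_ != _).
  have /pow_coverP[l ltl def_v] : v != 0%R by apply: contraNneq nkv => ->; rewrite mem0v.
  by exists l => //; move: Tv nkv; case: def_v => ->; rewrite ?memvN => -> ->.
have nelk : l != k by apply: contraNneq nkl => ->; rewrite memv_line.
(* Dividing by alpha^k moves the point k to 0 and l to m = l - k modulo 364; adding 364 only changes
   the sign of alpha^l. *)
have [m m_bounds Tm] : exists2 m, 0 < m < 364 & T = iter k (lfun_img mul_alpha) (line m).
  have defT : T = (<[alpha_pow k]> + <[alpha_pow l]>)%VS.
    apply/eqP; rewrite eq_sym eqEdim subv_add -!memvE Tk Tl /= dimT.
    by rewrite dim_line_pow // eq_sym.
  case: (ltnP k l) => [ltkl|lelk].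
    by exists (l - k); [lia | rewrite line_iter subnKC // ltnW].
  exists (l + 364 - k); first lia.
  rewrite line_iter subnKC ?pow_half; last by lia.
  by rewrite defT; congr (_ + _)%VS; apply/eqP; rewrite eqEsubv -!memvE !memvN memv_line
     -(memvN _ (alpha_pow l)) memv_line.
have [j base_j [u def_m]] := line_base m_bounds.
rewrite Tm def_m; do 2!apply: degree_iter => {}b; exact: degree_base.
Qed.

Theorem theorem1 :
  exists (q : nat) (F : finFieldType) (n k t lambda N : nat)
         (B : 'I_N -> {set {vspace 'rV[F]_n}}),
    [/\ prime_power q, #|F| = q,
        [/\ 2 <= t, t < k & k < n],
        1 <= lambda /\ 2 <= N
      & large_set t k lambda B].
Proof.
exists 3, 'F_3, 6, 3, 2, 20, 2.
exists (fun i => [set U | (\dim U == 3) && (block U == (i == ord0))]).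
split=> //; first by exists 3, 1.
  by rewrite card_Fp.
split=> [i | i j neq_ij |].
- split=> [|T]; first by apply/subsetP=> U; rewrite !inE => /andP[].
  rewrite inE => /eqP/(degree_line (i == ord0)) <-.
  by apply: eq_card => U; rewrite !inE -andbA; congr (_ && _); rewrite andbC.
- apply/pred0P=> U /=; rewrite !inE; apply/negP.
  case/andP=> /andP[_ /eqP->] /andP[_ /eqP eq_ij].
  case/negP: neq_ij; move: eq_ij; rewrite -!val_eqE.
  by case: i => [[|[|]]] //; case: j => [[|[|]]].
apply/setP=> U; rewrite inE; apply/bigcupP/idP=> [[i _]|dimU].
  by rewrite inE => /andP[].
by exists (if block U then ord0 else lift ord0 ord0); rewrite // inE dimU; case: block.
Qed.
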